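(* Let $p$ be a prime number and let $\underline{R}=M(K_{3,2p-1})$ be the graphic matroid associated to the complete bipartite graph $K_{3,2p-1}$ (with parts of cardinalities $3$ and $2p-1$), with edge set $S$. Then any $\mathbb{F}_p$-solution $b=(b_s)_{s\in S}$ of $\underline{R}$ in the mod $p$ Albanese graph $\mathrm{Alb}_p(\underline{R})$ has trivial color profile $\lambda(b)=0\in\mathbb{F}_p^S$.
   Context: Let $G$ be a finite graph with vertex set $V$ and edge set $S$, and fix an orientation of each edge. Let $(e_s)_{s\in S}$ be the standard basis of $\mathbb{F}_p^S=C^1(G,\mathbb{F}_p)$. For the graphic matroid $\underline{R}=M(G)$ put $U_{\mathbb{F}_p}=B^1(G,\mathbb{F}_p)\subset\mathbb{F}_p^S$, the span of the coboundaries $\delta_v=\sum_{s\text{ ending at }v}e_s-\sum_{s\text{ starting at }v}e_s$, $v\in V$, and $W=\mathbb{F}_p^S/U_{\mathbb{F}_p}=H^1(G,\mathbb{F}_p)$. The image of $e_s$ in $W$ is again denoted $e_s$. The mod $p$ Albanese graph $\mathrm{Alb}_p(\underline{R})$ is the oriented, $S$-colored graph with vertex set $W$ that has, for each $w\in W$ and $s\in S$, one positively oriented edge $[w\to w+e_s]$ of color $s$ (the Cayley graph of $W$ with respect to the generators $e_s$). $C_1(\mathrm{Alb}_p(\underline{R}),\mathbb{F}_p)$ is the $\mathbb{F}_p$-vector space of 1-chains, with basis the positively oriented edges, and $\partial[w\to w+e_s]=[w+e_s]-[w]$. A 1-chain of color $s$ is a linear combination of edges of color $s$. An $\mathbb{F}_p$-solution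 of $\underline{R}$ in $\mathrm{Alb}_p(\underline{R})$ is a collection $b=(b_s)_{s\in S}$ of 1-chains $b_s\in C_1(\mathrm{Alb}_p(\underline{R}),\mathbb{F}_p)$ of color $s$ such that, whenever $c_s\in\mathbb{F}_p$ satisfy $\sum_{s\in S}c_se_s\in U_{\mathbb{F}_p}\subset\mathbb{F}_p^S$, one has $\partial\sum_{s\in S}c_sb_s=0$. For such $b_s$, $\lambda_s(b_s)\in\mathbb{F}_p$ is the sum of the coefficients of $b_s$ when written as a linear combination of positively oriented edges of color $s$; the color profile of $b$ is $\lambda(b)=(\lambda_s(b_s))_{s\in S}\in\mathbb{F}_p^S$. *)

(* Defs.v *)
From HB Require Import structures.
From mathcomp Require Import all_boot all_algebra.

Set Implicit Arguments.
Unset Strict Implicit.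
Unset Printing Implicit Defensive.

Import GRing.Theory.
Local Open Scope ring_scope.
Local Open Scope quotient_scope.

(* A finite graph with a fixed orientation of each edge; loops and parallel
   edges are allowed. *)
Record ograph := OGraph {
  vertex : finType;
  edge : finType;
  source : edge -> vertex;
  target : edge -> vertex
}.

(* The complete bipartite graph K_{m,n}; [o] chooses the orientation of each
   edge, [true] meaning "from the part of size m to the part of size n". *)
Definition complete_bipartite (m n : nat) (o : 'I_m * 'I_n -> bool) : ograph :=
  @OGraph ('I_m + 'I_n)%type ('I_m * 'I_n)%type
    (fun s => if o s then inl s.1 else inr s.2)
    (fun s => if o s then inr s.2 else inl s.1).

(* F_p^T for a finite type T.  The regular module ('F_p)^o, rather than 'F_p, is
   what gives {ffun T -> _} its structure of 'F_p-vector space.  When p is not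
   prime, 'F_p is F_q for some prime q. *)
Notation Fpow p T := {ffun T -> ('F_p)^o}.

Definition unitv (p : nat) (T : finType) (t : T) : Fpow p T :=
  [ffun u => (u == t)%:R].

Section Chains.
Variables (p : nat) (G : ograph).

Definition chain0 := Fpow p (vertex G).
Definition chain1 := Fpow p (edge G).

Definition boundary (c : chain1) : chain0 :=
  \sum_(x : edge G) c x *: (unitv p (target x) - unitv p (source x)).

Definition coboundary (v : vertex G) : Fpow p (edge G) :=
  \sum_(s | target s == v) unitv p s - \sum_(s | source s == v) unitv p s.

Definition B1 : {vspace Fpow p (edge G)} :=
  <<[seq coboundary v | v : vertex G]>>%VS.

End Chains.

Section Albanese.
Variables (p : nat) (S : finType) (U : {vspace Fpow p S}).

(* F_p^S / U, as the quotient of additive groups: the Cayley graph uses only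
   the addition. *)
Definition modU := Quotient.quot (pred_of_vspace U).

HB.instance Definition _ := GRing.Zmodule.on modU.
HB.instance Definition _ := Countable.copy modU (can_type (@reprK _ modU)).
HB.instance Definition _ := isFinite.Build modU
  (pcan_enumP (can_pcan (@reprK _ modU))).

Definition unit_modU (s : S) : modU := \pi_modU (unitv p s).

(* The edge (w, s) is [w -> w + e_s], of color s. *)
Definition Alb : ograph :=
  @OGraph modU (modU * S)%type (fun x => x.1) (fun x => x.1 + unit_modU x.2).

Definition color (x : edge Alb) : S := x.2.

Definition of_color (s : S) (c : chain1 p Alb) : Prop :=
  forall x : edge Alb, color x != s -> c x = 0.

Definition is_solution (b : S -> chain1 p Alb) : Prop :=
  (forall s, of_color s (b s)) /\
  (forall c : S -> 'F_p,
     \sum_s c s *: unitv p s \in U -> boundary (\sum_s c s *: b s) = 0).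

(* When [c] has color [s], this is the sum of all its coefficients. *)
Definition lambda (s : S) (c : chain1 p Alb) : 'F_p :=
  \sum_(x : edge Alb | color x == s) c x.

Definition color_profile (b : S -> chain1 p Alb) : Fpow p S :=
  [ffun s => lambda s (b s)].

End Albanese.

(* Main.v *)
Require Import Defs.
From mathcomp Require Import all_boot all_algebra.
From mathcomp Require Import finfield zify ring.

(** The proof exhibits a dual certificate. View m in F_p^S as a
    3 x (2p-1) matrix with entries m_ij; then W is the quotient by the matrices
    r_i + c_j. Suppose that every vertex v carries a function Phi_v on W such
    that, for each edge s, the function Phi_target(s) - Phi_source(s) changes by
    a constant c_s under translation by e_s. Pairing Phi_v with the cycle
    relation of the coboundary delta_v and summing over v gives
    sum_s c_s lambda_s(b_s) = 0.

    For an edge (i0, j0) a certificate with c supported on that edge is built as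
    follows. Let i0, i1, i2 be the three rows, a_j = m_{i0 j} - m_{i2 j} and
    b_j = m_{i1 j} - m_{i2 j}; functions on W are the functions of (a, b)
    invariant under a_j -> a_j + c and under b_j -> b_j + d. Up to signs, let
    E = e_p(a) and E_j = e_{p-1}(a without a_j). For 2p-1 variables in
    characteristic p, E(a + c) = E(a) + c for c in F_p, E_j(a + c) = E_j(a) and
    sum_j E_j = 0, so the functions E - a_{j0} (for i0),
    E - a_{j0} - sum_j b_j E_j (for i1), 0 (for i2) and
    ((b_j - a_j) - (b_k - a_k)) E_j (for j, with some k <> j) are invariant.
    As E is affine in each variable a_j, with slope E_j, the sum of the
    functions of i and j changes by -[(i,j) = (i0,j0)] when m_ij increases by 1. *)

Set Implicit Arguments.
Unset Strict Implicit.
Unset Printing Implicit Defensive.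

Import GRing.Theory.
Local Open Scope ring_scope.

(** * Derivatives of products, and translation of polynomials over F_p *)

Lemma deriv_prod_ord (R : comNzRingType) (n : nat) (F : 'I_n -> {poly R}) :
  (\prod_j F j)^`() = \sum_j (F j)^`() * \prod_(k | k != j) F k.
Proof.
elim: n F => [|n IHn] F; first by rewrite !big_ord0 derivE.
rewrite big_ord_recl derivM IHn big_ord_recl; congr (_ * _ + _).
  rewrite [RHS]big_mkcond big_ord_recl /= mul1r; exact: eq_bigr.
rewrite mulr_sumr; apply: eq_bigr => j _.
rewrite [in RHS]big_mkcond big_ord_recl /= mulrCA.
by congr (_ * (_ * _)); rewrite big_mkcond.
Qed.

Section CoefShift.
Variables (F : finFieldType) (p : nat) (p_pr : prime p) (cardF : #|F| = p).

Let p_gt0 : (0 < p)%N := prime_gt0 p_pr.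

Let expFp (c : F) : c ^+ p = c.
Proof. by rewrite -[RHS]expf_card cardF. Qed.

Let pcharF : p \in [pchar F].
Proof. by apply: (@card_finPcharP _ _ 1). Qed.

Lemma coef_exp_XsubC_small (c : F) i : (i < p)%N ->
  (('X - c%:P) ^+ i)`_p.-1 = (i == p.-1)%:R.
Proof.
move=> ltip; case: eqP => [->|/eqP nei].
  have := monicP (monic_exp p.-1 (monicXsubC c)).
  by rewrite /lead_coef size_exp_XsubC.
by rewrite nth_default // size_exp_XsubC; lia.
Qed.

(* By Frobenius, (X - c)^(p + i) = (X^p - c) (X - c)^i. *)
Lemma coef_exp_XsubC_large (c : F) i : (i < p)%N ->
  (('X - c%:P) ^+ (p + i))`_p.-1 = - c * (i == p.-1)%:R.
Proof.
move=> ltip; rewrite exprD -polyCN exprDn_pchar; last first.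
  by rewrite pnatE // pchar_poly.
rewrite -polyC_exp expFp mulrDl coefD coefXnM ltn_predL p_gt0 add0r.
by rewrite coefCM polyCN coef_exp_XsubC_small.
Qed.

(** Among the powers of X - c with exponent below 2p, only the exponents p - 1 and 2p - 1 can
    contribute to the coefficient of degree p - 1, with values 1 and -c. *)
Lemma coef_comp_XsubC (Q : {poly F}) (c : F) : (size Q <= 2 * p)%N ->
  (Q \Po ('X - c%:P))`_p.-1 = Q`_p.-1 - c * Q`_(2 * p - 1).
Proof.
move=> sQ; rewrite comp_polyE coef_sum.
under eq_bigr do rewrite coefZ.
(* Pad with zero coefficients to exactly 2p terms, so that the sum splits at p. *)
rewrite (big_ord_widen _ (fun i => Q`_i * (('X - c%:P) ^+ i)`_p.-1) sQ).
rewrite big_mkcond /=.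
rewrite (eq_bigr (fun i : 'I__ => Q`_i * (('X - c%:P) ^+ i)`_p.-1)); last first.
  by move=> i _; case: ltnP => // /(nth_default 0) ->; rewrite mul0r.
rewrite mul2n -addnn big_split_ord /=; congr (_ + _).
  under eq_bigr => i _ do rewrite coef_exp_XsubC_small ?ltn_ord //=.
  rewrite (bigD1 (Ordinal (ltac:(by rewrite ltn_predL) : (p.-1 < p)%N))) //=.
  rewrite eqxx mulr1 big1 ?addr0 // => i; rewrite -val_eqE /= => /negPf ->.
  by rewrite mulr0.
under eq_bigr => i _ do rewrite coef_exp_XsubC_large ?ltn_ord //=.
rewrite (bigD1 (Ordinal (ltac:(by rewrite ltn_predL) : (p.-1 < p)%N))) //=.
rewrite eqxx mulr1 big1 ?addr0 => [|i]; last first.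
  by rewrite -val_eqE /= => /negPf ->; rewrite !mulr0.
by rewrite mulrN mulrC; congr (- (_ * Q`__)); lia.
Qed.

End CoefShift.

(** * Elementary symmetric functions under translation *)

Section ElementarySymmetric.
Variables (F : finFieldType) (p : nat) (p_pr : prime p) (cardF : #|F| = p).
Variables (n : nat) (n_eq : n = (2 * p - 1)%N).
Implicit Types (a : 'I_n -> F) (j : 'I_n) (c d : F).

(* [elemsym a] and [elemsym_but j a] are (-1)^(p - 1) times the elementary
   symmetric polynomials of degree p in the 2p - 1 variables a_k, respectively
   of degree p - 1 in the 2p - 2 variables a_k with k != j. *)
Definition elemsym a : F := - (\prod_k ('X - (a k)%:P))`_p.-1.
Definition elemsym_but j a : F := (\prod_(k | k != j) ('X - (a k)%:P))`_p.-1.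

Let p_gt0 : (0 < p)%N := prime_gt0 p_pr.

Lemma eq_elemsym a a' : a =1 a' -> elemsym a = elemsym a'.
Proof.
move=> e; rewrite /elemsym (eq_bigr (fun k => 'X - (a' k)%:P)) // => k _.
by rewrite e.
Qed.

Lemma eq_elemsym_but j a a' :
  (forall k, k != j -> a k = a' k) -> elemsym_but j a = elemsym_but j a'.
Proof.
move=> e; rewrite /elemsym_but (eq_bigr (fun k => 'X - (a' k)%:P)) // => k /e.
by move->.
Qed.

Lemma elemsym_update j d a :
  elemsym (fun k => a k + d * (k == j)%:R) = elemsym a + d * elemsym_but j a.
Proof.
rewrite /elemsym /elemsym_but !(bigD1 (P := xpredT) j) //= eqxx mulr1.
rewrite (eq_bigr (fun k => 'X - (a k)%:P)) => [|k /negPf ->]; last first.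
  by rewrite mulr0 addr0.
by rewrite polyCD opprD addrA mulrDl coefD mulNr coefN coefCM opprD opprK.
Qed.

Lemma prod_shift (P : pred 'I_n) c a :
  \prod_(k | P k) ('X - (a k + c)%:P)
    = (\prod_(k | P k) ('X - (a k)%:P)) \Po ('X - c%:P).
Proof.
rewrite rmorph_prod; apply: eq_bigr => k _ /=.
by rewrite comp_polyB comp_polyX comp_polyC polyCD opprD addrA addrAC.
Qed.

(** The product is monic of degree 2p - 1, so the correction in [coef_comp_XsubC] is -c, and the
    sign in [elemsym] turns it into c. *)
Lemma elemsym_shift c a : elemsym (fun k => a k + c) = elemsym a + c.
Proof.
have sP: size (\prod_k ('X - (a k)%:P)) = (2 * p)%N.
  by rewrite -big_enum size_prod_XsubC size_enum_ord; lia.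
rewrite /elemsym prod_shift coef_comp_XsubC ?sP //.
have /monicP := monic_prod_XsubC (index_enum 'I_n) xpredT a.
by rewrite /lead_coef sP -subn1 => ->; ring.
Qed.

(** With one factor fewer, the coefficient of degree 2p - 1 vanishes. *)
Lemma elemsym_but_shift j c a :
  elemsym_but j (fun k => a k + c) = elemsym_but j a.
Proof.
have sP: (size (\prod_(k | k != j) ('X - (a k)%:P))%R <= 2 * p - 1)%N.
  rewrite (eq_bigl [in predC1 j]) => [|k]; last by rewrite !inE.
  by rewrite -big_enum size_prod_XsubC -cardE cardC1 card_ord; lia.
rewrite /elemsym_but prod_shift coef_comp_XsubC // ?(leq_trans sP) ?leq_subr //.
by rewrite (nth_default 0 sP) mulr0 subr0.
Qed.

(** By the Leibniz rule this is a coefficient of the derivative of the full product, namely p times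
    its coefficient of degree p. *)
Lemma sum_elemsym_but a : \sum_j elemsym_but j a = 0.
Proof.
transitivity ((\prod_k ('X - (a k)%:P))^`())`_p.-1; last first.
  by rewrite coef_deriv prednK // mulrn_pchar // (@card_finPcharP _ _ 1).
rewrite deriv_prod_ord coef_sum; apply: eq_bigr => j _.
by rewrite derivXsubC mul1r.
Qed.

End ElementarySymmetric.

(** * Coboundaries and summation by parts *)

Lemma sum_mul_delta (R : pzSemiRingType) (T : finType) (f : T -> R) (t : T) :
  \sum_u f u * (t == u)%:R = f t.
Proof.
rewrite (bigD1 t) //= eqxx mulr1 big1 ?addr0 // => u.
by rewrite eq_sym => /negPf ->; rewrite mulr0.
Qed.

Lemma unitvE (p : nat) (T : finType) (t u : T) : unitv p t u = (u == t)%:R.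
Proof. by rewrite ffunE. Qed.

Lemma sum_unitv (p : nat) (T : finType) (f : Fpow p T) :
  \sum_t f t *: unitv p t = f.
Proof.
apply/ffunP => u; rewrite sum_ffunE (bigD1 u) //= big1 => [|t /negPf ntu].
  by rewrite addr0 ffunE unitvE eqxx [LHS]mulr1.
by rewrite ffunE unitvE eq_sym ntu [LHS]mulr0.
Qed.

Lemma coboundaryE (p : nat) (G : ograph) (v : vertex G) (s : edge G) :
  coboundary p v s = (target s == v)%:R - (source s == v)%:R.
Proof.
rewrite ffunE sum_ffunE ffunE sum_ffunE /=.
congr (_ - _).
  rewrite big_mkcond (bigD1 s) //= unitvE eqxx big1 ?addr0; first by case: eqP.
  by move=> t /negPf nts; rewrite unitvE [s == t]eq_sym nts if_same.
rewrite big_mkcond (bigD1 s) //= unitvE eqxx big1 ?addr0; first by case: eqP.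
by move=> t /negPf nts; rewrite unitvE [s == t]eq_sym nts if_same.
Qed.

Lemma B1P (p : nat) (G : ograph) (u : Fpow p (edge G)) : u \in B1 p G ->
  exists y : vertex G -> 'F_p, forall s, u s = y (target s) - y (source s).
Proof.
move/(@coord_span _ _ _ (in_tuple _)) => ->.
elim/big_ind: _ => [|u1 u2 [y1 y1P] [y2 y2P]|i _].
- by exists (fun=> 0) => s; rewrite ffunE subrr.
- by exists (fun v => y1 v + y2 v) => s; rewrite ffunE y1P y2P; ring.
have /mapP[v _ ->]: (in_tuple [seq coboundary p v | v : vertex G])`_i
    \in [seq coboundary p v | v : vertex G] by rewrite mem_nth.
set k := coord _ _ _; exists (fun w => k * (w == v)%:R) => s.
by rewrite ffunE coboundaryE -mulrBr.
Qed.

Lemma sum_boundary (p : nat) (G : ograph) (f : vertex G -> 'F_p)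
    (c : chain1 p G) :
  \sum_w f w * boundary c w = \sum_x (f (target x) - f (source x)) * c x.
Proof.
under eq_bigr do rewrite sum_ffunE mulr_sumr.
rewrite exchange_big; apply: eq_bigr => x _.
under eq_bigr do rewrite !ffunE /= mulrCA.
rewrite -mulr_sumr mulrC; congr (_ * _).
under eq_bigr => w _.
  rewrite [w == target x]eq_sym [w == source x]eq_sym mulrBr; over.
by rewrite sumrB !sum_mul_delta.
Qed.

(** * Pairing vertex functions with a solution *)

Section Duality.
Variables (p : nat) (G : ograph).

Let W := modU (B1 p G).

Lemma repr_piD (w : W) (s : edge G) :
  repr (w + unit_modU (B1 p G) s) - (repr w + unitv p s) \in B1 p G.
Proof.
rewrite Quotient.idealrBE reprK; apply/eqP.
rewrite (Quotient.pi_add (pred_of_vspace (B1 p G))) reprK.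
reflexivity.
Qed.

Lemma lambda_pairing (Phi : vertex G -> Fpow p (edge G) -> 'F_p)
    (c : edge G -> 'F_p) (b : edge G -> chain1 p (Alb (B1 p G))) :
  (forall v m u, u \in B1 p G -> Phi v (m + u) = Phi v m) ->
  (forall s m, (Phi (target s) (m + unitv p s) - Phi (target s) m)
             - (Phi (source s) (m + unitv p s) - Phi (source s) m) = c s) ->
  is_solution b -> \sum_s c s * lambda s (b s) = 0.
Proof.
move=> PhiB PhiD [b_color b_cycle].
pose phi v (w : W) := Phi v (repr w).
have phiD v w s : phi v (w + unit_modU _ s) = Phi v (repr w + unitv p s).
  by rewrite -(PhiB _ _ _ (repr_piD w s)) subrKC.
have: \sum_v \sum_(w : vertex (Alb (B1 p G))) phi v w *
    boundary (\sum_s coboundary p v s *: b s) w = 0.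
  rewrite big1 // => v _; rewrite b_cycle; last first.
    rewrite sum_unitv; apply: memv_span; exact: image_f.
  by rewrite big1 // => w _; rewrite ffunE mulr0.
move=> eq0; rewrite -[RHS]eq0; under [RHS]eq_bigr do rewrite sum_boundary.
rewrite exchange_big /=.
have -> : \sum_s c s * lambda s (b s) = \sum_(x : edge (Alb (B1 p G)))
    c (color x) * b (color x) x.
  rewrite (partition_big (@color p _ (B1 p G)) xpredT) //=.
  apply: eq_bigr => s _.
  by rewrite mulr_sumr; apply: eq_bigr => x /eqP <-.
apply: eq_bigr => -[w s] _ /=.
(* Only the chain of color [s] is nonzero on an edge of color [s]. *)
have bE v : (\sum_t coboundary p v t *: b t) (w, s)
    = ((target s == v)%:R - (source s == v)%:R) * b s (w, s).
  rewrite sum_ffunE (bigD1 s) //= ffunE coboundaryE big1 ?addr0 // => t.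
  by rewrite eq_sym ffunE => nst; rewrite (b_color t (w, s) nst) [LHS]mulr0.
under [RHS]eq_bigr do rewrite bE mulrA mulrBr !phiD.
by rewrite -mulr_suml sumrB !sum_mul_delta PhiD.
Qed.
End Duality.

(** * Invariance and increments of the certificate *)

Section Certificate.
Variables (F : finFieldType) (p : nat) (p_pr : prime p) (cardF : #|F| = p).
Variables (n : nat) (n_eq : n = (2 * p - 1)%N).
Variables (j0 : 'I_n) (other : 'I_n -> 'I_n).
Hypothesis otherP : forall j, other j != j.
Implicit Types (a b : 'I_n -> F) (j : 'I_n) (c d e : F).

Definition row0 a : F := elemsym p a - a j0.
Definition row1 a b : F := row0 a - \sum_j b j * elemsym_but p j a.
Definition col j a b : F :=
  ((b j - a j) - (b (other j) - a (other j))) * elemsym_but p j a.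

Lemma row0_shift c a a' : (forall k, a' k = a k + c) -> row0 a' = row0 a.
Proof.
move=> a'E; rewrite /row0 (eq_elemsym p a'E) (elemsym_shift p_pr cardF n_eq).
by rewrite a'E; ring.
Qed.

Lemma col_shift c d j a a' b b' :
  (forall k, a' k = a k + c) -> (forall k, b' k = b k + d) ->
  col j a' b' = col j a b.
Proof.
move=> a'E b'E; rewrite /col (eq_elemsym_but p (fun k _ => a'E k)).
by rewrite (elemsym_but_shift p_pr cardF n_eq) !a'E !b'E; ring.
Qed.

Lemma row1_shift c d a a' b b' :
  (forall k, a' k = a k + c) -> (forall k, b' k = b k + d) ->
  row1 a' b' = row1 a b.
Proof.
move=> a'E b'E; rewrite /row1 (row0_shift a'E); congr (_ - _).
(* The shift of [b] contributes d times the sum of all E_j, which is zero. *)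
transitivity (\sum_j (b j * elemsym_but p j a + d * elemsym_but p j a)).
  apply: eq_bigr => j _; rewrite b'E -mulrDl.
  by rewrite (eq_elemsym_but p (fun k _ => a'E k)) (elemsym_but_shift p_pr cardF n_eq).
by rewrite big_split /= -mulr_sumr (sum_elemsym_but p_pr cardF) mulr0 addr0.
Qed.

Lemma row0_update d j a a' : (forall k, a' k = a k + d * (k == j)%:R) ->
  row0 a' = row0 a + d * elemsym_but p j a - d * (j0 == j)%:R.
Proof.
by move=> a'E; rewrite /row0 (eq_elemsym p a'E) elemsym_update a'E; ring.
Qed.

Lemma row1_update e j a a' b b' :
  a' =1 a -> (forall k, b' k = b k + e * (k == j)%:R) ->
  row1 a' b' = row1 a b - e * elemsym_but p j a.
Proof.
move=> a'E b'E.
have -> : row1 a' b' = row0 a - \sum_k b' k * elemsym_but p k a'.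
  by rewrite /row1 /row0 (eq_elemsym p a'E) a'E.
rewrite /row1 -[RHS]addrA -opprD; congr (_ - _).
transitivity (\sum_k (b k * elemsym_but p k a
                       + e * elemsym_but p k a * (j == k)%:R)).
  apply: eq_bigr => k _; rewrite b'E (eq_elemsym_but p (fun l _ => a'E l)).
  by rewrite [j == k]eq_sym; ring.
by rewrite big_split sum_mul_delta.
Qed.

Lemma col_update d e j a a' b b' :
  (forall k, a' k = a k + d * (k == j)%:R) ->
  (forall k, b' k = b k + e * (k == j)%:R) ->
  col j a' b' = col j a b + (e - d) * elemsym_but p j a.
Proof.
move=> a'E b'E; rewrite /col (@eq_elemsym_but _ p _ j a' a) => [|k /negPf nkj].
  by rewrite !a'E !b'E eqxx (negPf (otherP j)) !mulr1 !mulr0; ring.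
by rewrite a'E nkj mulr0 addr0.
Qed.

End Certificate.

(** * The certificate on the complete bipartite graph *)

Section CompleteBipartite.
Variables (p : nat) (p_pr : prime p) (n : nat) (n_eq : n = (2 * p - 1)%N).
Variable o : 'I_3 * 'I_n -> bool.

Let G := complete_bipartite o.

Implicit Types (m u : Fpow p (edge G)) (i : 'I_3) (j : 'I_n).

(* The coordinates of [m] once all edges are oriented from the part of size 3 to
   the part of size n. *)
Definition entry m i j : 'F_p := if o (i, j) then m (i, j) else - m (i, j).

Lemma entry_B1 u : u \in B1 p G -> exists y : vertex G -> 'F_p,
  forall m i j, entry (m + u) i j = entry m i j + (y (inr j) - y (inl i)).
Proof.
move/B1P => [y uE]; exists y => m i j; rewrite /entry ffunE uE /=.
by case: (o (i, j)); ring.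
Qed.

Definition orient (s : edge G) : 'F_p := if o s then 1 else -1.

Lemma entry_unitv m i j i' j' : entry (m + unitv p ((i, j) : edge G)) i' j'
  = entry m i' j' + orient (i, j) * ((i' == i) && (j' == j))%:R.
Proof.
rewrite /entry /orient ffunE unitvE xpair_eqE.
case: andP => [[/eqP -> /eqP ->]|_] /=; case: ifP => _; ring.
Qed.

Lemma lambda_edge (b : edge G -> chain1 p (Alb (B1 p G))) (i0 i1 i2 : 'I_3) j0 :
  uniq [:: i0; i1; i2] -> is_solution b -> lambda (i0, j0) (b (i0, j0)) = 0.
Proof.
move=> i_uniq b_sol.
(* The cyclic successor [ordS] serves as [other]; it has no fixed point once n > 1. *)
have n_gt1 : (1 < n)%N by have := prime_gt1 p_pr; lia.
have otherP j : ordS j != j.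
  rewrite -val_eqE /=; have := ltn_ord j.
  rewrite leq_eqVlt => /predU1P[jn|ltjn].
    by rewrite jn modnn; lia.
  by rewrite modn_small //; lia.
pose xa m k := entry m i0 k - entry m i2 k.
pose xb m k := entry m i1 k - entry m i2 k.
pose row i m : 'F_p := if i == i0 then row0 p j0 (xa m)
  else if i == i1 then row1 p j0 (xa m) (xb m) else 0.
pose Phi (v : vertex G) m : 'F_p := match v with
  | inl i => - row i m
  | inr j => col p (@ordS n) j (xa m) (xb m)
  end.
pose c (s : edge G) : 'F_p := - (s == (i0, j0))%:R.
have cardF := card_Fp p_pr.
have PhiB v m u : u \in B1 p G -> Phi v (m + u) = Phi v m.
  move/entry_B1 => [y entryE].
  have xaE k : xa (m + u) k = xa m k + (y (inl i2) - y (inl i0)).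
    by rewrite /xa !entryE; ring.
  have xbE k : xb (m + u) k = xb m k + (y (inl i2) - y (inl i1)).
    by rewrite /xb !entryE; ring.
  case: v => [i|j] /=; last exact: (col_shift p_pr cardF n_eq).
  rewrite /row (row0_shift p_pr cardF n_eq _ xaE).
  by rewrite (row1_shift p_pr cardF n_eq _ xaE xbE).
suff PhiD (s : edge G) m : (Phi (target s) (m + unitv p s) - Phi (target s) m)
    - (Phi (source s) (m + unitv p s) - Phi (source s) m) = c s.
  have := lambda_pairing PhiB PhiD b_sol.
  rewrite (bigD1 (i0, j0)) //= /c eqxx big1 ?addr0 => [|s /negPf ->].
    by move/eqP; rewrite mulN1r oppr_eq0 => /eqP.
  by rewrite oppr0 mul0r.
case: s => i j; set m' := m + _.
(* Reversing an edge swaps source and target, which costs the sign [orient]; the minus sign in [Phi]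
   on rows turns the difference into a sum. *)
suff step : (row i m' - row i m)
    + (col p (@ordS n) j (xa m') (xb m') - col p (@ordS n) j (xa m) (xb m))
    = orient (i, j) * c (i, j).
  move: step; rewrite /orient /=; case: ifP => _ /=; rewrite ?mul1r ?mulN1r.
    by move=> <-; rewrite opprB opprK addrC [- _ + _]addrC.
  move=> step; rewrite -[RHS]opprK -step [RHS]opprD; congr (_ - _).
  by rewrite opprK opprB addrC.
have entryE k l : entry m' k l = _ := entry_unitv m i j k l.
have [i10 i20 i21] : [/\ i1 != i0, i2 != i0 & i2 != i1].
  move: i_uniq; rewrite /= !inE negb_or !andbT => /andP[/andP[i01 i02] i12].
  by split; rewrite eq_sym.
have : i \in [:: i0; i1; i2].
  have /card_uniqP s3 := i_uniq.
  by rewrite (subset_cardP _ (subset_predT _)) // s3 card_ord.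
set sg := orient (i, j) in entryE *.
pose d := sg * ((i0 == i)%:R - (i2 == i)%:R).
pose e := sg * ((i1 == i)%:R - (i2 == i)%:R).
have xaE k : xa m' k = xa m k + d * (k == j)%:R.
  by rewrite /xa !entryE -!mulnb !natrM /d; ring.
have xbE k : xb m' k = xb m k + e * (k == j)%:R.
  by rewrite /xb !entryE -!mulnb !natrM /e; ring.
(* The column term changes by (e - d) E_j, where (d, e) is (sg, 0), (0, sg) or (-sg, -sg) according
   to the row; the row term cancels it up to the delta at [j0]. *)
rewrite (col_update p otherP xaE xbE) [col _ _ _ _ _ + _]addrC addrK.
rewrite /c xpair_eqE.
rewrite !inE => /or3P[] /eqP eq_i.
- have row_i u : row i u = row0 p j0 (xa u) by rewrite /row eq_i eqxx.
  have dE : d = sg by rewrite /d eq_i eqxx (negPf i20) subr0 mulr1.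
  have eE : e = 0 by rewrite /e eq_i (negPf i10) (negPf i20) subrr mulr0.
  rewrite !row_i (row0_update p j0 xaE) dE eE eq_i eqxx /= [j == _]eq_sym.
  by ring.
- have row_i u : row i u = row1 p j0 (xa u) (xb u).
    by rewrite /row eq_i eqxx (negPf i10).
  have dE : d = 0.
    by rewrite /d eq_i [i0 == _]eq_sym (negPf i10) (negPf i21) subrr mulr0.
  have eE : e = sg by rewrite /e eq_i eqxx (negPf i21) subr0 mulr1.
  have xaE0 : xa m' =1 xa m by move=> k; rewrite xaE dE mul0r addr0.
  rewrite !row_i (row1_update p j0 xaE0 xbE) dE eE eq_i (negPf i10) /=.
  by ring.
have row_i u : row i u = 0 by rewrite /row eq_i (negPf i20) (negPf i21).
have de : d = e.
  by rewrite /d /e eq_i [i0 == _]eq_sym [i1 == _]eq_sym (negPf i20) (negPf i21).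
by rewrite !row_i de eq_i (negPf i20) /=; ring.
Qed.

End CompleteBipartite.

Theorem theorem1p7 (p : nat) (p_pr : prime p)
    (o : 'I_3 * 'I_(2 * p - 1)%N -> bool)
    (G := complete_bipartite o)
    (b : edge G -> chain1 p (Alb (B1 p G))) :
  is_solution b -> color_profile b = 0.
Proof.
move=> b_sol; apply/ffunP => -[i j]; rewrite !ffunE.
(* The cyclic neighbors of [i] are the other two rows. *)
apply: (lambda_edge p_pr erefl (i1 := ordS i) (i2 := ord_pred i)) => //.
by case: i => [[|[|[|]]] ?].
Qed.
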